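(* Let $\mathcal{U}$ be any Fubini iterate of p-points. If $\mathcal{V}$ is an ultrafilter on $\omega$ with $\mathcal{V}\le_T\mathcal{U}$, then $\mathcal{V}$ has finitely generated Tukey reductions.
   Context: A p-point is a nonprincipal ultrafilter on $\omega$ such that every decreasing sequence of its members has a member almost contained in each. Fubini product: $\lim_{n\to\mathcal{W}}\mathcal{V}_n=\{A\subseteq\omega\times\omega:\{n:\{j:(n,j)\in A\}\in\mathcal{V}_n\}\in\mathcal{W}\}$ (analogously on other countable bases). Let $\mathcal{P}_0$ be the set of p-points, $\mathcal{P}_{\alpha+1}=\{\lim_{n\to\mathcal{W}}\mathcal{V}_n:\mathcal{W}\in\mathcal{P}_0,\ \mathcal{V}_n\in\mathcal{P}_\alpha\}$, and $\mathcal{P}_\lambda=\bigcup_{\beta<\lambda}\mathcal{P}_\beta$ for limit $\lambda$; a Fubini iterate of p-points is a member of $\bigcup_{\alpha<\omega_1}\mathcal{P}_\alpha$. A map between ultrafilters is monotone if $X\supseteq Y\Rightarrow f(X)\supseteq f(Y)$ and cofinal if it sends cofinal subsets of $(\cdot,\supseteq)$ to cofinal subsets; $\mathcal{V}\le_T\mathcal{U}$ iff a cofinal map $\mathcal{U}\to\mathcal{V}$ exists. Subsets of $\omega$ are identified with characteristic functions; $X\restriction k$ denotes $X\cap k$ as a function on domain $k$. An ultrafilter $\mathcal{V}$ on $\omega$ has finitely generated Tukey reductions if for every monotone cofinal map $f:\mathcal{V}\to\mathcal{W}$ there are a cofinal $\mathcal{D}\subseteq\mathcal{V}$, an increasing sequence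 $(k_m)_{m<\omega}$, and a function $\hat f:D\to2^{<\omega}$ with $D=\{X\restriction k_m:X\in\mathcal{D},m<\omega\}$, such that $\hat f$ is level preserving ($|s|=k_m\Rightarrow|\hat f(s)|=m$), monotone ($s\subseteq t\Rightarrow\hat f(s)\subseteq\hat f(t)$ as sets of $1$-positions), and $f(X)=\bigcup_{m<\omega}\hat f(X\restriction k_m)$ for every $X\in\mathcal{D}$.
   Formalization: The ultrafilter V is assumed nonprincipal; for every principal V the claim fails with the definition as given (a constant map onto {b} with b large is monotone and cofinal but is not finitely generated). *)

(* Defs.v *)
From mathcomp Require Import all_boot.
From mathcomp Require Import boolp classical_sets functions cardinality filter.
From mathcomp Require wochoice.

Set Implicit Arguments.
Unset Strict Implicit.
Unset Printing Implicit Defensive.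

Local Open Scope classical_set_scope.

Definition nonprincipal (T : Type) (U : set_system T) : Prop :=
  forall x : T, U <> principal_filter x.

Definition p_point (U : set_system nat) : Prop :=
  [/\ UltraFilter U, nonprincipal U &
      forall A : nat -> set nat,
        (forall n, U (A n)) -> (forall n, A n.+1 `<=` A n) ->
        exists2 B, U B & forall n, finite_set (B `\` A n)].

(* The V_n may live on different bases (this happens above limit levels of the
   hierarchy below), so the base of the limit is the disjoint sum of the bases;
   when every base is nat it is the set of pairs (n, j). *)
Definition fubini_lim (W : set_system nat) (Bs : nat -> Type)
    (V : forall n, set_system (Bs n)) : set_system {n : nat & Bs n} :=
  [set A | W [set n | V n [set j | A (existT Bs n j)]]].

Section Positions.
Variable R : rel nat.

Definition pos_lt (a b : nat) : Prop := R a b /\ a <> b.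

Definition pos_zero (a : nat) : Prop := forall b, ~ pos_lt b a.

Definition pos_succ (a b : nat) : Prop :=
  pos_lt a b /\ forall c, ~ (pos_lt a c /\ pos_lt c b).

Definition pos_limit (a : nat) : Prop :=
  ~ pos_zero a /\ forall b, ~ pos_succ b a.

End Positions.

(* When R is a well-order of nat and a has order type alpha in it (i.e. the set
   of its strict predecessors has order type alpha), fubini_level R a is the
   class P_alpha of the hierarchy: every a is exactly one of zero, successor, limit. *)
Inductive fubini_level (R : rel nat) :
    nat -> forall B : Type, set_system B -> Prop :=
| Level_zero a (W : set_system nat) :
    pos_zero R a -> p_point W -> @fubini_level R a nat W
| Level_succ a b (W : set_system nat) (Bs : nat -> Type)
    (V : forall n, set_system (Bs n)) :
    pos_succ R a b -> p_point W ->
    (forall n, @fubini_level R a (Bs n) (V n)) ->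
    @fubini_level R b {n : nat & Bs n} (fubini_lim W V)
| Level_limit a b (B : Type) (U : set_system B) :
    pos_limit R a -> pos_lt R b a ->
    @fubini_level R b B U -> @fubini_level R a B U.

(* The countable ordinals are exactly the order types of the positions in
   well-orders of nat. *)
Definition fubini_iterate (B : Type) (U : set_system B) : Prop :=
  exists2 R : rel nat, wochoice.well_order R & exists a, fubini_level R a U.

Definition cofinal_subset (T : Type) (U D : set_system T) : Prop :=
  D `<=` U /\ forall X, U X -> exists2 Y, D Y & Y `<=` X.

(* A map U -> V is a function on all sets, constrained on the members of U. *)
Definition cofinal_map (S T : Type) (U : set_system S) (V : set_system T)
    (f : set S -> set T) : Prop :=
  set_fun U V f /\
  forall D, cofinal_subset U D -> cofinal_subset V (f @` D).

Definition monotone_map (S T : Type) (U : set_system S)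
    (f : set S -> set T) : Prop :=
  forall X Y, U X -> U Y -> Y `<=` X -> f Y `<=` f X.

Definition tukey_le (S T : Type) (V : set_system T) (U : set_system S) : Prop :=
  exists f : set S -> set T, cofinal_map U V f.

Definition restr (X : set nat) (k : nat) : seq bool :=
  mkseq (fun i => `[< X i >]) k.

Definition ones (s : seq bool) : set nat := [set i | nth false s i].

Definition finitely_generated_tukey_reductions (V : set_system nat) : Prop :=
  forall (W : set_system nat) (f : set nat -> set nat),
    UltraFilter W -> monotone_map V f -> cofinal_map V W f ->
  exists (D : set_system nat) (k : nat -> nat) (fhat : seq bool -> seq bool),
    let dom := [set s | exists X m, D X /\ s = restr X (k m)] in
    [/\ cofinal_subset V D,
        {homo k : m n / m < n},
        forall s m, dom s -> size s = k m -> size (fhat s) = m,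
        forall s t, dom s -> dom t ->
          ones s `<=` ones t -> ones (fhat s) `<=` ones (fhat t) &
        forall X, D X -> f X = \bigcup_m ones (fhat (restr X (k m)))].

(* Main.v *)
(** A Fubini iterate of p-points has a base indexed by the trees on [nat] whose
    node t branches into a set of a p-point [P t]; such trees may be continued
    forever, so the rank of the iterate plays no role.  Diagonalising over all
    nodes at once, with gaps common to the first n nodes, any monotone map psi
    from such trees to sets of numbers becomes continuous below a single tree T:
    whether n is in psi S depends on finitely many nodes of S only.

    Given a monotone cofinal g : U -> V and a monotone f on V, take T for both g
    and f o g, and let D be the image under g of the trees below T.  A
    compactness argument shows that for Y in D and n in f Y some finite part of
    Y forces n into f Y' for every Y' in D that contains it; this is finite
    generation, with k_m = m. *)

Require Import Defs.
From mathcomp Require Import all_boot.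
From mathcomp Require Import boolp classical_sets functions cardinality filter.

Set Implicit Arguments.
Unset Strict Implicit.
Unset Printing Implicit Defensive.

Local Open Scope classical_set_scope.

(** * Ultrafilters and p-points on [nat] *)

Section Ultrafilters.
Variables (U : set_system nat) (ultraU : UltraFilter U) (npU : nonprincipal U).

Lemma ultra_setC (A : set nat) : ~ U A -> U (~` A).
Proof. by case: (in_ultra_setVsetC A ultraU). Qed.

Lemma nonprincipal_setC1 (x : nat) : U (~` [set x]).
Proof.
apply: ultra_setC => Ux; apply: (npU (x := x)).
apply/esym/max_filter.
  exact: (@ultra_proper _ _ (principal_filter_ultra x)).
move=> A UA; apply/principal_filterP.
by have [y [-> ]] := filter_ex (filterI Ux UA).
Qed.

Lemma nonprincipal_ge (k : nat) : U [set m | k <= m].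
Proof.
elim: k => [|k IHk]; first by apply: filterS filterT.
apply: filterS (filterI IHk (nonprincipal_setC1 k)) => m [/= km mk].
by rewrite ltn_neqAle km andbT; apply/eqP => e; apply: mk.
Qed.

Lemma nonprincipal_unbounded (A : set nat) (k : nat) :
  U A -> exists2 m, A m & k <= m.
Proof.
by move=> UA; have [m []] := filter_ex (filterI UA (nonprincipal_ge k)); exists m.
Qed.

End Ultrafilters.

Lemma filter_seq (I : eqType) T (U : set_system T) {FU : Filter U}
    (A : I -> set T) (s : seq I) :
  (forall i, i \in s -> U (A i)) ->
  U [set x | forall i, i \in s -> A i x].
Proof.
elim: s => [|i s IHs] UA; first by apply: filterS filterT.
have UAs : U [set x | forall j, j \in s -> A j x].
  by apply: IHs => j js; apply: UA; rewrite inE js orbT.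
apply: filterS (filterI (UA i (mem_head _ _)) UAs) => x [Ai As] j.
by rewrite inE => /orP[/eqP->//|/As].
Qed.

(** Replacing each [A k] by the intersection of [A 0], ..., [A k] makes the sequence decreasing;
    [g k] bounds the finite remainder of [B]. *)
Lemma p_point_pseudo_intersection (U : set_system nat) (A : nat -> set nat) :
  p_point U -> (forall k, U (A k)) ->
  exists (B : set nat) (g : nat -> nat),
    U B /\ forall k m, B m -> g k <= m -> A k m.
Proof.
move=> [uU npU hU] UA.
pose A' k := [set m | forall i, i \in iota 0 k.+1 -> A i m].
have [||B UB hB] := hU A'.
- by move=> k; apply: filter_seq => i _.
- move=> k m hm i; rewrite mem_iota /= add0n ltnS => ik.
  by apply: hm; rewrite mem_iota /= add0n ltnS leqW.
suff [g hg] : {g : nat -> nat & forall k m, B m -> g k <= m -> A k m} by exists B, g.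
apply: (@choice _ _ (fun k b => forall m, B m -> b <= m -> A k m)) => k.
have /finite_seqP[s hs] := hB k.
exists (\max_(i <- s) i).+1 => m Bm lm; apply: contrapT => nA.
have : m \in s.
  have : (B `\` A' k) m by split=> // /(_ k); rewrite mem_iota /= add0n ltnS leqnn => /(_ isT).
  by rewrite hs.
by move=> /(@leq_bigmax_seq _ s predT id m)/(_ isT); rewrite leqNgt lm.
Qed.

(** Serves to find a gap common to finitely many nodes: digit [l] of the block index [e] will be
    prescribed by the node of code [l]. *)
Lemma binary_digits (b : nat -> bool) (n : nat) :
  exists2 e, n < e & forall l, l < n -> odd (e %/ 2 ^ l) = b l.
Proof.
elim: n b => [|n IHn] b; first by exists 1.
have [e ne he] := IHn (b \o succn).
exists (b 0 + e.*2).
  by rewrite (leq_trans _ (leq_addl _ _))// -addnn -addn1 leq_add// (leq_ltn_trans _ ne).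
case=> [_|l ln]; first by rewrite divn1 oddD odd_double addbF oddb.
by rewrite expnS divnMA divn2 half_bit_double he.
Qed.

(** * Trees branching into p-points *)

Section Trees.
Variable P : seq nat -> set_system nat.

Definition good (T : set (seq nat)) : Prop :=
  [/\ T [::], forall t m, T (rcons t m) -> T t &
      forall t, T t -> P t [set m | T (rcons t m)]].

Definition tree_of (Q : seq nat -> set nat) : set (seq nat) :=
  [set x | forall i, i < size x -> Q (take i x) (nth 0 x i)].

Lemma tree_of_rcons Q t m :
  tree_of Q (rcons t m) <-> tree_of Q t /\ Q t m.
Proof.
split=> [h|[ht hm] i].
  split=> [i it|].
    have := h i; rewrite size_rcons ltnS (ltnW it) => /(_ isT).
    by rewrite nth_rcons it -cats1 takel_cat// ltnW.
  have := h (size t); rewrite size_rcons leqnn => /(_ isT).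
  by rewrite nth_rcons ltnn eqxx -cats1 take_size_cat.
rewrite size_rcons ltnS leq_eqVlt => /orP[/eqP->|it].
  by rewrite nth_rcons ltnn eqxx -cats1 take_size_cat.
by rewrite nth_rcons it -cats1 (takel_cat _ (ltnW it)); apply: ht.
Qed.

Lemma good_tree_of Q : (forall t, Filter (P t)) ->
  (forall t, tree_of Q t -> P t (Q t)) -> good (tree_of Q).
Proof.
move=> FP PQ; split=> [//|t m /tree_of_rcons[]//|t ht].
by apply: filterS (PQ t ht) => m Qm; apply/tree_of_rcons.
Qed.

Lemma goodI S T : (forall t, Filter (P t)) -> good S -> good T -> good (S `&` T).
Proof.
move=> FP [S0 Sp SP] [T0 Tp TP]; split=> // [t m [/Sp ? /Tp ?]//|t [St Tt]].
exact: filterI (SP _ St) (TP _ Tt).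
Qed.

(* Up to agreement on F, finitely many members of C represent all of C, and R
   is the intersection of their successor sets. *)
Lemma uniform_successors (F : seq (seq nat)) (C : set (set (seq nat))) :
  (forall t, Filter (P t)) -> C `<=` good ->
  exists2 R : seq nat -> set nat, forall t, P t (R t) &
    forall S, C S -> exists T, [/\ C T, forall x, x \in F -> T x <-> S x &
      forall t m, T t -> R t m -> T (rcons t m)].
Proof.
move=> FP; elim: F C => [|x F IHF] C Cg.
  have [[T CT]|C0] := pselect (exists T, C T); last first.
    by exists (fun=> setT) => [t|S CS]; [exact: filterT | case: C0; exists S].
  exists (fun t => [set m | T t -> T (rcons t m)]) => [t|S CS].
    have [Tt|nTt] := pselect (T t); last by apply: filterS filterT => m _ /nTt.
    by have [_ _ /(_ _ Tt) PT] := Cg _ CT; apply: filterS PT => m Tm _.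
  by exists T; split=> // t m Tt; apply.
(* Representatives are chosen separately for the members of [C] that contain [x] and for those that
   omit it. *)
have [|R1 PR1 hR1] := IHF [set S | C S /\ S x]; first by move=> S [/Cg].
have [|R2 PR2 hR2] := IHF [set S | C S /\ ~ S x]; first by move=> S [/Cg].
exists (fun t => R1 t `&` R2 t) => [t|S CS]; first exact: filterI.
have [Sx|nSx] := pselect (S x).
- have [//|T [[CT Tx] TF TR]] := hR1 S; exists T; split=> //.
    by move=> y; rewrite inE => /orP[/eqP->|/TF].
  by move=> t m Tt [Rm _]; apply: TR.
- have [//|T [[CT Tx] TF TR]] := hR2 S; exists T; split=> //.
    by move=> y; rewrite inE => /orP[/eqP->|/TF].
  by move=> t m Tt [_ Rm]; apply: TR.
Qed.

Definition cutoff_nodes (k n : nat) : seq (seq nat) :=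
  [seq rcons (odflt [::] (unpickle l)) m | l <- iota 0 n.+1, m <- iota 0 k].

Lemma mem_cutoff_nodes k n t m :
  pickle t <= n -> m < k -> rcons t m \in cutoff_nodes k n.
Proof.
move=> tn mk; apply/allpairsP; exists (pickle t, m).
by split; rewrite ?pickleK// mem_iota !add0n.
Qed.

Hypothesis pP : forall t, p_point (P t).

#[local] Instance ultraP t : UltraFilter (P t).
Proof. by case: (pP t). Qed.

(* The gaps: blocks [kk e, kk e.+1) are long enough to pass from R_(kk e) to its
   pseudo-intersection, and node t omits all blocks whose binary digit of rank
   pickle t is a fixed b t, so that infinitely many blocks are omitted by all of
   the first n nodes at once. *)
Lemma tree_continuity (psi : set (seq nat) -> set nat) :
  (forall S T, good S -> good T -> S `<=` T -> psi S `<=` psi T) ->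
  exists2 T, good T & forall n, exists F : seq (seq nat),
    forall S S', good S -> good S' -> S `<=` T -> S' `<=` T ->
      (forall x, x \in F -> S x -> S' x) -> psi S n -> psi S' n.
Proof.
move=> psi_mono.
have /choice[R hR] (kn : nat * nat) : exists R : seq nat -> set nat,
    (forall t, P t (R t)) /\
    forall S, good S -> ~ psi S kn.2 -> exists T, [/\ good T /\ ~ psi T kn.2,
      forall x, x \in cutoff_nodes kn.1 kn.2 -> T x <-> S x &
      forall t m, T t -> R t m -> T (rcons t m)].
  have [|R PR hR] := @uniform_successors (cutoff_nodes kn.1 kn.2)
    [set S | good S /\ ~ psi S kn.2] _; first by move=> S [].
  by exists R; split=> // S gS nS; apply: hR.
pose A t k := [set m | forall n, n \in iota 0 k.+1 -> R (k, n) t m].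
have PA t k : P t (A t k) by apply: filter_seq => n _; exact: (hR _).1.
have /choice[Bg hBg] t : exists Bg : set nat * (nat -> nat),
    P t Bg.1 /\ forall k m, Bg.1 m -> Bg.2 k <= m -> A t k m.
  by have [B [g]] := p_point_pseudo_intersection (pP t) (PA t); exists (B, g).
pose nd l : seq nat := odflt [::] (unpickle l).
(* [kk i.+1] lies beyond the threshold at [kk i] of every node of code at most [i]. *)
pose kk := nat_rect (fun=> nat) 0
  (fun i k => (maxn k (\max_(l < i.+1) (Bg (nd l)).2 k)).+1).
have kkS i : kk i < kk i.+1 by rewrite /= ltnS leq_maxl.
have kk_mono i j : i <= j -> kk i <= kk j.
  by apply: (homo_leq leqnn leq_trans) => {}i; apply: ltnW.
have kk_ge i : i <= kk i by elim: i => // i IHi; rewrite (leq_ltn_trans IHi).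
have kk_g (t : seq nat) i : pickle t <= i -> (Bg t).2 (kk i) <= kk i.+1.
  rewrite -ltnS => ti; rewrite /= leqW// leq_max; apply/orP; right.
  have := @leq_bigmax _ (fun l : 'I_i.+1 => (Bg (nd l)).2 (kk i)) (Ordinal ti).
  by rewrite [nd _](_ : _ = t)// /nd pickleK.
pose O (t : seq nat) b := [set m | exists e, [/\ kk e <= m, m < kk e.+1 &
  odd (e %/ 2 ^ (pickle t)) = b]].
have O_disj t m : O t true m -> O t false m -> False.
  move=> [e [em me oe]] [e' [em' me' oe']].
  suff ee : e = e' by move: oe; rewrite ee oe'.
  apply/eqP; rewrite eqn_leq; apply/andP; split; rewrite leqNgt; apply/negP.
    by move=> /kk_mono h; have := leq_trans (leq_trans me' h) em; rewrite ltnn.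
  by move=> /kk_mono h; have := leq_trans (leq_trans me h) em'; rewrite ltnn.
(* Blocks of opposite digits are disjoint, so at most one of the two unions is in [P t]. *)
have /choice[b hb] t : exists b, P t (~` O t b).
  have [PO|PO] := in_ultra_setVsetC (O t true) (ultraP t); last by exists true.
  by exists false; apply: filterS PO => m Ot Of; exact: (O_disj t m).
have /choice[ee hee] n : exists e, n < e /\
    forall t : seq nat, pickle t <= n -> odd (e %/ 2 ^ (pickle t)) = b t.
  have [e ne he] := binary_digits (b \o nd) n.+1.
  by exists e; split=> [|t tn]; [exact: ltnW | rewrite he// /nd /comp pickleK].
(* The last condition serves nodes of code above [n]; each node meets it for finitely many [n]
   only. *)
pose Q (t : seq nat) := [set m | [/\ (Bg t).1 m, (~` O t (b t)) m &
  forall n, n \in iota 0 (pickle t) -> A t (kk (ee n)) m]].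
have gQ : good (tree_of Q).
  apply: good_tree_of => t _.
  have h1 : P t [set m | forall n, n \in iota 0 (pickle t) -> A t (kk (ee n)) m].
    by apply: filter_seq.
  by apply: filterS (filterI (hBg t).1 (filterI (hb t) h1)) => m [? []].
exists (tree_of Q) => // n.
have [ne he] := hee n; set e := ee n in ne he.
have nk : n <= kk e by rewrite (leq_trans (ltnW ne)).
exists (cutoff_nodes (kk e) n) => S S' gS gS' ST ST' SF Sn.
apply: contrapT => nS'n.
(* It remains to put [S] inside [T]: nodes of code above [n] use the last condition of [Q], labels
   below [kk e] the agreement on [cutoff_nodes], and all other labels lie beyond the gap. *)
have [T [[gT nT] TF TR]] := (hR (kk e, n)).2 S' gS' nS'n.
apply: nT; apply: (psi_mono S) Sn => //.
apply: last_ind => [_|t m IHt Stm]; first by case: gT.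
have Tt : T t by apply: IHt; case: gS => _ + _; apply; exact: Stm.
have [_ [Bm nO hA]] := (tree_of_rcons Q t m).1 (ST _ Stm).
have nin : n \in iota 0 (kk e).+1 by rewrite mem_iota /= add0n ltnS.
have [tn|tn] := leqP (pickle t) n; last first.
  by apply: TR => //; apply: hA => //; rewrite mem_iota.
have [mk|km] := ltnP m (kk e).
  have xF := mem_cutoff_nodes tn mk.
  by apply/TF => //; apply: SF.
apply: TR => //; apply: (hBg t).2 => //.
rewrite (leq_trans (kk_g _ _ (leq_trans tn (ltnW ne))))// leqNgt.
by apply/negP => mk; apply: nO; exists e; split=> //; exact: he.
Qed.

End Trees.

(** * Fubini iterates as trees *)

(** Induction on the level: a successor step puts [W] at the root and the trees for [V n] above the
    child [n]; a limit step changes nothing. The map [c] lists the coordinates of a base point. *)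
Lemma fubini_level_trees (R : rel nat) (a : nat) (B : Type) (U : set_system B) :
  fubini_level R a U ->
  exists (P : seq nat -> set_system nat) (c : B -> seq nat),
    [/\ forall t, p_point (P t), forall T, good P T -> U (c @^-1` T) &
        forall X, U X -> exists2 T, good P T & c @^-1` T `<=` X].
Proof.
elim=> {a B U} [a W _ pW|a b W Bs V _ pW _ IH|//].
  have FW : Filter W by case: pW => uW _ _; exact: filter_filter.
  exists (fun=> W), (fun n => [:: n]); split=> // [T [T0 _ TP]|X WX].
    exact: (TP [::]).
  exists [set t | if t is n :: _ then X n else True].
    split=> // [[|? ?]//|[|n t] /= h]; last by apply: filterS filterT.
    exact: WX.
  by move=> n.
have FW : Filter W by case: pW => uW _ _; exact: filter_filter.
have /choice[P hP] n : exists P : seq nat -> set_system nat,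
    exists (c : Bs n -> seq nat),
    [/\ forall t, p_point (P t), forall T, good P T -> V n (c @^-1` T) &
        forall X, V n X -> exists2 T, good P T & c @^-1` T `<=` X].
  exact: IH.
have [c hc] : exists c : forall n, Bs n -> seq nat, forall n,
    [/\ forall t, p_point (P n t), forall T, good (P n) T -> V n (c n @^-1` T) &
        forall X, V n X -> exists2 T, good (P n) T & c n @^-1` T `<=` X].
  by exists (fun n => projT1 (cid (hP n))) => n; case: (cid (hP n)).
exists (fun t => if t is n :: t' then P n t' else W),
       (fun x => projT1 x :: c _ (projT2 x)); split.
- by case=> [//|n t]; have [] := hc n.
- move=> T [T0 Tp TP]; apply: filterS (TP [::] T0) => n /= Tn.
  have [_ hT _] := hc n; apply: (hT [set t | T (n :: t)]); split=> //.
    by move=> t m; exact: (Tp (n :: t)).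
  by move=> t; exact: (TP (n :: t)).
- move=> X WX; pose Xn n := [set j | X (existT Bs n j)].
  have {}WX : W [set n | V n (Xn n)] by [].
  (* Where [Xn n] is not in [V n] any [T] will do, as the child [n] is left out of the tree. *)
  have /choice[T hT] n : exists T, V n (Xn n) -> good (P n) T /\ c n @^-1` T `<=` Xn n.
    have [h|nh] := pselect (V n (Xn n)); last by exists setT.
    by have [_ _ /(_ _ h)[T gT TX]] := hc n; exists T.
  exists [set t | if t is n :: t' then V n (Xn n) /\ T n t' else True].
    split=> // [[|n t] m //=|[|n t] /=].
    + by move=> [Vn]; have [[_ Tp _] _] := hT n Vn => /Tp.
    + move=> _; apply: filterS WX => n Vn; split=> //.
      by have [[]] := hT n Vn.
    + move=> [Vn Tt]; have [[_ _ TP] _] := hT n Vn.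
      have [p _ _] := hc n; have [up _ _] := p t.
      by apply: filterS (TP t Tt).
  by move=> [n j] /= [Vn Tj]; have [_] := hT n Vn; apply.
Qed.

(** * Finite generation *)

(** The union of [g] over smaller members of [U] is monotone. Were it never inside [Y], the [X] with
    [g X] not inside [Y] would be cofinal, but their images are not. *)
Lemma tukey_le_monotone (S T : Type) (U : set_system S) (V : set_system T) :
  Filter V -> tukey_le V U ->
  exists g : set S -> set T,
    [/\ forall X Y, X `<=` Y -> g X `<=` g Y, set_fun U V g &
        forall Y, V Y -> exists2 X, U X & g X `<=` Y].
Proof.
move=> FV [g [gUV gcof]].
exists (fun X => \bigcup_(X' in [set X' | U X' /\ X' `<=` X]) g X'); split.
- move=> X Y XY y [X' [UX' X'X] gy]; exists X' => //; split=> //.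
  exact: subset_trans XY.
- by move=> X UX; apply: filterS (gUV X UX) => y gy; exists X => //; split.
- move=> Y VY; apply: contrapT => nX.
  pose D := [set X | U X /\ ~ g X `<=` Y].
  have [|_ /(_ Y VY)[_ [X [_ nXY]] <- //]] := gcof D.
  split=> [X []//|X UX]; apply: contrapT => nD; apply: nX.
  exists X => // y [X' [UX' X'X] gy]; apply: contrapT => nYy.
  by apply: nD; exists X' => //; split=> // /(_ _ gy).
Qed.

Section FiniteGeneration.
Variables (P : seq nat -> set_system nat) (pP : forall t, p_point (P t)).
Variables (V : set_system nat) (ultraV : UltraFilter V) (npV : nonprincipal V).
Variables (gam : set (seq nat) -> set nat) (f : set nat -> set nat).
Hypothesis gam_mono : forall S T, S `<=` T -> gam S `<=` gam T.
Hypothesis gamV : forall S, good P S -> V (gam S).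
Hypothesis f_mono : monotone_map V f.

#[local] Instance filterP t : Filter (P t).
Proof. by have uP := ultraP pP t; exact: filter_filter. Qed.

(* Compactness: counterexamples [Sm m] would have a limit [L] along [V], which
   need not be a good tree, but becomes one after adding all nodes that are not
   above the finitely many nodes of [H] missing from [L]. *)
Lemma finite_support (T : set (seq nat)) (S0 : set (seq nat)) (n : nat)
    (F : nat -> seq (seq nat)) (H : seq (seq nat)) :
  good P T -> good P S0 ->
  (forall i S S', good P S -> good P S' -> S `<=` T -> S' `<=` T ->
      (forall x, x \in F i -> S x -> S' x) -> gam S i -> gam S' i) ->
  (forall S S', good P S -> good P S' -> S `<=` T -> S' `<=` T ->
      (forall x, x \in H -> S x -> S' x) -> f (gam S) n -> f (gam S') n) ->
  f (gam S0) n ->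
  exists m, forall S, good P S -> S `<=` T ->
    (forall i, i < m -> gam S0 i -> gam S i) -> f (gam S) n.
Proof.
move=> gT gS0 hF hH fn; apply: contrapT => nm.
have /choice[Sm hSm] m : exists S, [/\ good P S, S `<=` T,
    forall i, i < m -> gam S0 i -> gam S i & ~ f (gam S) n].
  apply: contrapT => nS; apply: nm; exists m => S gS ST h.
  by apply: contrapT => nf; apply: nS; exists S.
pose L := [set x | V [set m | Sm m x]].
have L0 : L [::] by apply: filterS filterT => m _; have [[]] := hSm m.
have Lp t m : L (rcons t m) -> L t.
  by apply: filterS => i /=; have [[_ + _] _ _ _] := hSm i; apply.
have LT : L `<=` T by move=> x /filter_ex[m]; have [_ + _ _] := hSm m; apply.
have limitP (s : seq (seq nat)) : V [set m | forall x, x \in s -> Sm m x <-> L x].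
  apply: filter_seq => x _; have [Lx|nLx] := pselect (L x).
    by apply: filterS (Lx) => m Sx; split.
  by apply: filterS (ultra_setC ultraV nLx) => m nS; split=> [/nS|/nLx].
pose Q t := [set m | T (rcons t m) /\ (rcons t m \in H -> L (rcons t m))].
have QT : tree_of Q `<=` T.
  by apply: last_ind => [_|t m _ /tree_of_rcons[_ []]//]; case: gT.
have gQ : good P (tree_of Q).
  apply: good_tree_of => t /QT Tt; have [_ _ /(_ t Tt) PT] := gT.
  have [uP npP _] := pP t.
  have PH : P t [set m | forall x, x \in H -> x != rcons t m].
    apply: filter_seq => x _; elim/last_ind: x => [|x k _].
      by apply: filterS filterT => m _; case: t {Tt PT uP npP}.
    apply: filterS (nonprincipal_setC1 uP npP k) => m mk.
    by rewrite eqseq_rcons negb_and orbC; apply/orP; left; apply/eqP => e; apply: mk.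
  by apply: filterS (filterI PT PH) => m [? h]; split=> // /h; rewrite eqxx.
have LQ : L `<=` tree_of Q.
  apply: last_ind => [//|t m IHt Ltm]; apply/tree_of_rcons.
  by split; [apply: IHt; exact: Lp Ltm | split=> //; exact: LT].
have QH x : x \in H -> tree_of Q x -> L x.
  by elim/last_ind: x => [//|t m _ xH /tree_of_rcons[_ [_]]]; apply.
(* Given [i], take [m > i] such that [Sm m] agrees with [L] on [F i]: then [i] passes from [gam S0]
   to [gam (Sm m)], and by continuity to [gam (tree_of Q)]. *)
have sub : gam S0 `<=` gam (tree_of Q).
  move=> i gi.
  have [m [hm im]] := filter_ex (filterI (limitP (F i)) (nonprincipal_ge ultraV npV i.+1)).
  have [gSm SmT hgam _] := hSm m.
  apply: (hF i (Sm m)) => //; last exact: hgam.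
  by move=> x xF /(hm _ xF); exact: LQ.
have fQ : f (gam (tree_of Q)) n by apply: f_mono fn => //; apply: gamV.
(* Some [Sm m] agrees with [L] on [H], so it contains every node of [H] in [tree_of Q], and
   continuity applies. *)
have [m hm] := filter_ex (limitP H).
have [gSm SmT _] := hSm m; apply.
apply: (hH (tree_of Q)) => // x xH Qx.
by apply/(hm _ xH); exact: QH.
Qed.

(** Interleaving [gam] at even and [f \o gam] at odd numbers makes one tree serve both maps. *)
Lemma finite_support_below_tree :
  exists2 T, good P T & forall S0 n, good P S0 -> f (gam S0) n ->
    exists m, forall S, good P S -> S `<=` T ->
      (forall i, i < m -> gam S0 i -> gam S i) -> f (gam S) n.
Proof.
pose psi S := [set i | if odd i then f (gam S) i./2 else gam S i./2].
have [|T gT hT] := tree_continuity pP (psi := psi).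
  move=> S S' gS gS' SS' i; rewrite /psi /=; case: ifP => _.
    by apply: f_mono; [exact: gamV|exact: gamV|exact: gam_mono].
  exact: gam_mono.
have /choice[F hF] := hT.
exists T => // S0 n gS0 fn.
apply: (finite_support (F := fun i => F i.*2) (H := F n.*2.+1) gT gS0) fn.
  move=> i S S' gS gS' ST S'T SF gi.
  by have := hF i.*2 S S' gS gS' ST S'T SF; rewrite /psi /= odd_double doubleK; apply.
move=> S S' gS gS' ST S'T SF gi.
have := hF n.*2.+1 S S' gS gS' ST S'T SF.
by rewrite /psi /= odd_double /= uphalf_double; apply.
Qed.

End FiniteGeneration.

(** * From finite support to maps on finite sequences *)

Lemma ones_restr (X : set nat) k i : ones (restr X k) i <-> i < k /\ X i.
Proof.
rewrite /ones /restr /=; have [ik|ki] := ltnP i k.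
  by rewrite nth_mkseq//; split=> [/asboolP//|[_ Xi]]; apply/asboolP.
by rewrite nth_default ?size_mkseq//; split=> // -[].
Qed.

(* The condition [exists i >= n in s] makes fhat monotone across different
   lengths, where t may be shorter than s. *)
Lemma fhat_of_finite_support (V D : set_system nat) (f : set nat -> set nat) :
  UltraFilter V -> nonprincipal V -> cofinal_subset V D ->
  (forall X n, D X -> f X n -> exists m, forall Y, D Y ->
     (forall i, i < m -> X i -> Y i) -> f Y n) ->
  exists (k : nat -> nat) (fhat : seq bool -> seq bool),
    let dom := [set s | exists X m, D X /\ s = restr X (k m)] in
    [/\ {homo k : m n / m < n},
        forall s m, dom s -> size s = k m -> size (fhat s) = m,
        forall s t, dom s -> dom t ->
          ones s `<=` ones t -> ones (fhat s) `<=` ones (fhat t) &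
        forall X, D X -> f X = \bigcup_m ones (fhat (restr X (k m)))].
Proof.
move=> uV npV [DV _] hD.
pose gen s := [set n | (exists2 i, n <= i & ones s i) /\
  forall Y, D Y -> ones s `<=` Y -> f Y n].
(* Cutting off at [size s] preserves levels with [k = id] and loses nothing, since [n <= i < size s]
   for [n] in [gen s]. *)
pose fhat s := restr (gen s) (size s).
have genP s n : ones (fhat s) n <-> gen s n.
  split=> [/ones_restr[]//|gn]; apply/ones_restr; split=> //.
  have [[i ni si] _] := gn; rewrite ltnNge; apply/negP => sn.
  by move: si; rewrite /ones /= nth_default// (leq_trans sn).
exists id, fhat; split=> [//|s m _ <-|s t _ _ st n /genP[[i ni si] h]|X DX].
- by rewrite size_mkseq.
- apply/genP; split; first by exists i => //; exact: st.
  by move=> Y DY tY; apply: h => //; exact: subset_trans tY.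
- apply/seteqP; split=> [n fn|n [m _ /genP[_]]]; last first.
    by apply=> // i /ones_restr[].
  have [m hm] := hD X n DX fn.
  (* Members of [V] are unbounded, so some [i] in [X] reaches both [n] and the support bound [m]. *)
  have [i Xi im] := nonprincipal_unbounded uV npV (maxn n m) (DV _ DX).
  move: im; rewrite geq_max => /andP[ni mi].
  exists i.+1 => //; apply/genP; split; first by exists i => //; apply/ones_restr.
  move=> Y DY XY; apply: hm => // l lm Xl; apply: XY; apply/ones_restr; split=> //.
  by rewrite ltnS (leq_trans (ltnW lm)).
Qed.

Theorem theorem6p3 (B : Type) (U : set_system B) (hU : fubini_iterate U)
    (V : set_system nat) (ultraV : UltraFilter V) (npV : nonprincipal V)
    (hVU : tukey_le V U) :
  finitely_generated_tukey_reductions V.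
Proof.
move=> W f _ f_mono _.
have [R _ [a /fubini_level_trees[P [c [pP PU UP]]]]] := hU.
have FP t : Filter (P t) by have [uP _ _] := pP t; exact: filter_filter.
have FV : Filter V by exact: filter_filter.
have [g [g_mono gUV gcof]] := tukey_le_monotone FV hVU.
pose gam T := g (c @^-1` T).
have gam_mono S T : S `<=` T -> gam S `<=` gam T.
  by move=> ST; apply: g_mono => b; exact: ST.
have gamV S : good P S -> V (gam S) by move=> gS; apply: gUV; exact: PU.
have [T gT hT] := finite_support_below_tree pP ultraV npV gam_mono gamV f_mono.
pose D := [set gam S | S in [set S | good P S /\ S `<=` T]].
have Dcof : cofinal_subset V D.
  split=> [_ [S [gS _] <-]|Y VY]; first exact: gamV.
  have [X UX gXY] := gcof Y VY; have [S gS SX] := UP X UX.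
  (* Intersecting with [T] keeps the tree good, so trees below [T] suffice for cofinality. *)
  exists (gam (S `&` T)).
    by exists (S `&` T) => //; split; [exact: goodI | move=> x []].
  by apply: subset_trans gXY; apply: g_mono => b [Sb _]; exact: SX.
have [|k [fhat [? ? ? ?]]] := fhat_of_finite_support (f := f) ultraV npV Dcof.
  move=> _ n [S0 [gS0 _] <-] fn; have [m hm] := hT S0 n gS0 fn.
  by exists m => _ [S [gS ST] <-]; exact: hm.
by exists D, k, fhat.
Qed.
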